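(* Let $t\ge 4$ be an integer and let $G$ be a $t$-tough graph on $n\ge 3$ vertices with degree sequence $d_1\le d_2\le \dots\le d_n$. Suppose that for each integer $i$ with $1\le i\le \lfloor\frac{n-1}{2}\rfloor$ the following implication holds: if $d_i\le i$ and $d_{n-i+t}<n-i$, then $d_j+d_{n-j+t}\ge n$ for all integers $j$ with $i+1\le j\le \lfloor\frac{n-1}{2}\rfloor$. Then $G$ is Hamiltonian.
   Context: All graphs are finite and simple. $c(H)$ denotes the number of connected components of a graph $H$. The toughness $\tau(G)$ of a non-complete graph $G$ is $\min\{|S|/c(G-S) : S\subseteq V(G),\ c(G-S)\ge 2\}$, and $\tau(G)=\infty$ if $G$ is complete. $G$ is $t$-tough if $\tau(G)\ge t$. The degree sequence of a graph on $n$ vertices is the non-decreasing sequence $d_1\le d_2\le\dots\le d_n$ such that the vertices can be labeled $v_1,\dots,v_n$ with $d(v_i)=d_i$ for every $i$. A graph is Hamiltonian if it has a cycle through all its vertices. Convention on indices: the implication for $i$ is vacuous unless $d_i\le i$. If $i\le\lfloor\frac{n-1}{2}\rfloor$ and $d_i\le i$, then $G$ is not complete, so its minimum degree is at least $2t$ and hence $i\ge 2t$. Therefore all indices $n-i+t$ and $n-j+t$ that matter lie in $\{1,\dots,n\}$. *)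

(* Defs.v *)
From mathcomp Require Import all_boot all_order all_algebra.
From mathcomp Require Import constructive_ereal.

Set Implicit Arguments.
Unset Strict Implicit.
Unset Printing Implicit Defensive.

Import Order.TTheory GRing.Theory Num.Theory.

(* A finite simple graph is a symmetric irreflexive relation on a finType. *)
Definition simple_graph (T : finType) (e : rel T) : Prop :=
  symmetric e /\ irreflexive e.

Definition complete (T : finType) (e : rel T) : bool :=
  [forall x, forall y, (x != y) ==> e x y].

Definition del_rel (T : finType) (e : rel T) (S : {set T}) : rel T :=
  [rel x y | [&& x \notin S, y \notin S & e x y]].

(* c(G - S).  In del_rel e S the vertices of S are isolated rather than absent;
   ~: S is closed under it, and only the components inside ~: S are counted. *)
Definition ncomp_del (T : finType) (e : rel T) (S : {set T}) : nat :=
  n_comp (del_rel e S) (~: S).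

(* The starting value +oo of the iterated minimum is immaterial: a non-complete graph
   has some S with c(G - S) >= 2, e.g. all vertices but two non-adjacent ones. *)
Definition toughness (T : finType) (e : rel T) : \bar rat :=
  if complete e then +oo%E
  else \big[Order.min/+oo%E]_(S : {set T} | 2 <= ncomp_del e S)
         ((#|S|%:R / (ncomp_del e S)%:R)%R)%:E.

Definition tough (T : finType) (e : rel T) (t : rat) : Prop :=
  (t%:E <= toughness e)%E.

Definition degree (T : finType) (e : rel T) (x : T) : nat := #|[set y | e x y]|.

(* d_i, indexed from 1; the value is only meaningful for 1 <= i <= #|T|. *)
Definition deg_seq (T : finType) (e : rel T) (i : nat) : nat :=
  nth 0 (sort leq [seq degree e x | x <- enum T]) i.-1.

(* The bound on the size excludes the degenerate cycles x and x - y - x that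
   MathComp's cycle predicate admits. *)
Definition hamiltonian (T : finType) (e : rel T) : Prop :=
  exists c : seq T, [/\ 3 <= size c, ucycle e c & forall x : T, x \in c].

(* Main.v *)
Require Import Defs.
From mathcomp Require Import all_boot all_order all_algebra.
From mathcomp Require Import constructive_ereal zify.
From Stdlib Require Import Classical_Prop.

(* Enlarge the graph to an edge-maximal non-Hamiltonian one; the hypotheses survive.  The key
   point is a closure lemma: nonadjacent x and y then satisfy d(x) + d(y) < n - t.

   Closure lemma.  Take a Hamiltonian path x = 0, 1, ..., N = y and label the edge [j, j+1] by X
   if x ~ j+1, by Y if y ~ j, by O otherwise; no edge is labelled twice, and the degree condition
   leaves at most t - 1 labels O.  Let A be the vertices both of whose path neighbours are adjacent
   to x, and B those whose path neighbours are both adjacent to y.  A vertex at which a rotated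
   Hamiltonian path from x ends is not adjacent to A, as long as the rotations keep the path edges
   at A (Posa).  Rotating inside each gap, that is, a subword Y O ... O X, yields one vertex per
   gap without neighbours in A or B, and these vertices are independent.  So removing all other
   vertices leaves at least 2 + g components, g being the number of gaps.  Counting along the
   label word, at most 2 (t - 1) + 3 g + 1 < t (2 + g) vertices were removed, against toughness.

   Degrees.  Call i a defect if d_i <= i and d_(n-i+t) < n - i; the hypothesis forbids two
   defects up to m = (n-1)/2.  In the closed graph every degree s <= m - t has fewer than s + t
   vertices of degree at most s.  It follows that at least m - t vertices have degree >= n - m and
   that they are adjacent to everything.  On a Hamiltonian path between two nonadjacent vertices
   their successors, with the first vertex, form an independent set too large for toughness. *)

Set Implicit Arguments.
Unset Strict Implicit.
Unset Printing Implicit Defensive.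

Import Order.TTheory GRing.Theory Num.Theory.

(** * Reversed paths and intervals of integers *)

Lemma path_revl (T : eqType) (r : rel T) (x y : T) (s : seq T) :
  symmetric r -> path r x s -> r y (last x s) -> path r y (rev (x :: s)).
Proof.
move=> rC xs yl; have e : x :: s = rcons (belast x s) (last x s) by rewrite lastI.
rewrite e rev_rcons /= yl rev_path /=.
by rewrite (eq_path (e' := r)) // => a b /=; rewrite rC.
Qed.

Lemma last_rev_cons (T : Type) (x y : T) (s : seq T) : last y (rev (x :: s)) = x.
Proof. by rewrite rev_cons last_rcons. Qed.

Lemma path_iota (r : rel nat) (i k : nat) :
  (forall j, i <= j < i + k -> r j j.+1) -> path r i (iota i.+1 k).
Proof.
elim: k i => //= k IH i H; rewrite H ?IH //; last lia.
by move=> j Hj; apply: H; lia.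
Qed.

Lemma last_iota (i k : nat) : last i (iota i.+1 k) = i + k.
Proof. by elim: k i => [|k IH] i /=; rewrite ?addn0 // IH; lia. Qed.

Lemma iota_split (i k k1 : nat) : k1 <= k -> iota i k = iota i k1 ++ iota (i + k1) (k - k1).
Proof. by move=> h; rewrite -iotaD subnKC. Qed.

(** * Counting along a word of labels *)

Section Words.

Variable w : nat -> option bool.

(** [Some true], [Some false] and [None] are the letters X, Y and O. This is the last letter other
    than O before j, a virtual X preceding the word; so a [jump] is the final X of a gap. *)
Fixpoint prev (j : nat) : bool := if j is j'.+1 then odflt (prev j') (w j') else true.

Definition jump (j : nat) : bool := (w j == Some true) && ~~ prev j.

Definition windowA (m : nat) : bool :=
  [&& w m == Some true, w m.+2 == Some true & w m.+1 != Some false].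

Definition windowB (m : nat) : bool :=
  [&& w m.+1 == Some false, w m.+3 == Some false & w m.+2 != Some true].

(** Jumps and drops alternate, and the virtual initial X makes a drop come first. *)
Lemma sum_drop (n : nat) :
  \sum_(0 <= j < n) ((w j == Some false) && prev j) = \sum_(0 <= j < n) jump j + ~~ prev n.
Proof.
elim: n => [|n IH]; first by rewrite !big_geq.
rewrite !big_nat_recr //= IH /jump.
by case: (w n) => [[]|] /=; case: (prev n); rewrite ?addn0 //; lia.
Qed.

(* A potential: what the last three letters may still cost. *)
Definition pending (l : bool) (a b c : option bool) : nat :=
  if l then
    if c is None then 2 + (b == None)
    else (b != Some true) + ((a != Some true) || (b == Some false))
  else (c == None) + (b != Some false).

(** The windows at n only see the letters n to n + 3, so with [prev n] each induction step is a
    finite check. An O pays for 2 positions outside both windows, a jump for 3, a drop for 1. *)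
Lemma sum_windows (n : nat) : w 0 = Some true -> w 1 = Some true -> w 2 = Some true ->
  \sum_(0 <= m < n) (~~ windowA m && ~~ windowB m)
    + pending (prev n.+3) (w n) (w n.+1) (w n.+2)
  <= \sum_(0 <= j < n.+3) (2 * (w j == None) + 3 * jump j + ((w j == Some false) && prev j)).
Proof.
move=> w0 w1 w2; elim: n => [|n IH].
  by rewrite big_geq // /= w0 w1 w2.
rewrite big_nat_recr // [leqRHS]big_nat_recr //=.
apply: leq_trans (leq_add IH (leqnn _)); rewrite -!addnA leq_add2l.
rewrite /windowA /windowB /jump /=.
by case: (w n) => [[]|]; case: (w n.+1) => [[]|]; case: (w n.+2) => [[]|];
   case: (w n.+3) => [[]|]; case: (prev n).
Qed.

Lemma sum_windows_le (n : nat) :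
  w 0 = Some true -> w 1 = Some true -> w 2 = Some true ->
  \sum_(0 <= m < n) (~~ windowA m && ~~ windowB m)
  <= 2 * \sum_(0 <= j < n.+3) (w j == None) + 4 * \sum_(0 <= j < n.+3) jump j + 1.
Proof.
move=> w0 w1 w2; apply: leq_trans (leq_trans (leq_addr _ _) (sum_windows n w0 w1 w2)) _.
(* There is at most one more drop than jumps: hence 3 + 1 per jump and a final 1. *)
by rewrite !big_split /= sum_drop !big1_eq; case: (~~ _); lia.
Qed.

End Words.

(** * Hamiltonian paths without Hamiltonian cycles *)

Section HamiltonPath.

Variables (N : nat) (g : rel nat).
Hypothesis gC : symmetric g.
Hypothesis gP : forall i, i < N -> g i i.+1.
Hypothesis N2 : 2 <= N.
Hypothesis noham : forall s, perm_eq (0 :: s) (iota 0 N.+1) -> path g 0 s -> ~~ g 0 (last 0 s).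

(* [lab j] describes the edge [j, j.+1] of the Hamiltonian path 0, 1, ..., N; it is
   [Some true] if 0 is adjacent to [j.+1] and [Some false] if N is adjacent to [j]. *)
Definition lab (j : nat) : option bool :=
  if g 0 j.+1 then Some true else if g N j then Some false else None.

(* The labels shifted by two: the virtual labels at both ends put 0 in [sideA] and N in [sideB]. *)
Definition word (j : nat) : option bool :=
  if j < 2 then Some true else if j < N.+2 then lab j.-2 else Some false.

Definition sideA (m : nat) : bool := windowA word m.

Definition sideB (m : nat) : bool := (m <= N) && windowB word m.

(* Paths for [gA] keep both path edges at every vertex of [sideA]. *)
Definition gA (i j : nat) : bool :=
  g i j && (sideA i || sideA j ==> (i == j.+1) || (j == i.+1)).

Lemma gA_sym : symmetric gA.
Proof. by move=> i j; rewrite /gA gC orbC [(i == _) || _]orbC. Qed.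

Lemma sub_gA : subrel gA g.
Proof. by move=> i j /andP[]. Qed.

Lemma gA_step (i : nat) : i < N -> gA i i.+1.
Proof. by move=> iN; rewrite /gA gP // eqxx orbT implybT. Qed.

Lemma gA_notA (i j : nat) : g i j -> ~~ sideA i -> ~~ sideA j -> gA i j.
Proof. by rewrite /gA => -> /negbTE-> /negbTE->. Qed.

Lemma no_ham (s : seq nat) :
  perm_eq (0 :: s) (iota 0 N.+1) -> path g 0 s -> g 0 (last 0 s) -> False.
Proof. by move=> p0 ps; apply/negP; apply: noham. Qed.

(** Otherwise 0, ..., j, N, ..., j + 1 closes to a Hamiltonian cycle. *)
Lemma lab_disjoint (j : nat) : j < N -> g 0 j.+1 -> g N j = false.
Proof.
move=> jN g0; apply/negP=> gN.
have eq : iota j.+1 (N - j) = j.+1 :: iota j.+2 (N - j).-1 by rewrite -[N - j]prednK //; lia.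
apply: (@no_ham (iota 1 j ++ rev (iota j.+1 (N - j)))).
- rewrite -cat_cons -[0 :: iota 1 j]/(iota 0 j.+1) (@iota_split 0 N.+1 j.+1); last lia.
  by apply: perm_cat => //; rewrite perm_rev add0n subSS.
- rewrite eq cat_path path_iota /=; last by move=> i Hi; apply: gP; lia.
  apply: path_revl => //; first by apply: path_iota => i Hi; apply: gP; lia.
  by rewrite !last_iota add0n gC (_ : j.+1 + _ = N) //; lia.
- by rewrite eq last_cat last_rev_cons.
Qed.

(** Otherwise 0, ..., k, N, ..., l + 1, k + 1, ..., l closes to a Hamiltonian cycle. *)
Lemma crossing_free (k l : nat) : k < l < N -> g k N -> g l 0 -> ~~ g k.+1 l.+1.
Proof.
move=> kl; pose s := iota 1 k ++ rev (iota l.+1 (N - l)) ++ iota k.+1 (l - k).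
have perm_s : perm_eq (0 :: s) (iota 0 N.+1).
  apply/permP=> P; rewrite -cat_cons -[0 :: iota 1 k]/(iota 0 k.+1).
  rewrite (@iota_split 0 N.+1 k.+1); last lia.
  rewrite add0n subSS (@iota_split k.+1 (N - k) (l - k)); last lia.
  rewrite (_ : k.+1 + (l - k) = l.+1) 1?(_ : N - k - (l - k) = N - l); try lia.
  by rewrite !count_cat count_rev; lia.
have eqN : iota l.+1 (N - l) = l.+1 :: iota l.+2 (N - l.+1).
  by rewrite (_ : N - l = (N - l.+1).+1) //; lia.
have eql : iota k.+1 (l - k) = k.+1 :: iota k.+2 (l - k.+1).
  by rewrite (_ : l - k = (l - k.+1).+1) //; lia.
have path1 : path g 0 (iota 1 k) by apply: path_iota => i Hi; apply: gP; lia.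
have path2 : path g l.+1 (iota l.+2 (N - l.+1)) by apply: path_iota => i Hi; apply: gP; lia.
have path3 : path g k.+1 (iota k.+2 (l - k.+1)) by apply: path_iota => i Hi; apply: gP; lia.
have last2 : last l.+1 (iota l.+2 (N - l.+1)) = N by rewrite last_iota; lia.
have last3 : last k.+1 (iota k.+2 (l - k.+1)) = l by rewrite last_iota; lia.
move=> gkN gl0; apply/negP=> gkl; apply: (no_ham perm_s).
  rewrite cat_path path1 last_iota cat_path eqN last_rev_cons eql /= gC gkl path3 !andbT.
  by apply: path_revl; rewrite ?last2.
by rewrite !last_cat eql /= last3 gC.
Qed.

Lemma wordX (j : nat) : (word j.+2 == Some true) = (j < N) && g 0 j.+1.
Proof.
rewrite /word /= !ltnS /lab; case: ltnP => // _ /=.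
by case: (g 0 j.+1); case: (g N j).
Qed.

Lemma wordY (j : nat) : j < N -> (word j.+2 == Some false) = g N j.
Proof.
move=> jN; rewrite /word /= !ltnS jN /lab.
by case g0: (g 0 j.+1); [rewrite (lab_disjoint jN g0) | case: (g N j)].
Qed.

Lemma sideA_facts (m : nat) : sideA m ->
  [/\ m < N, g 0 m.+1, (1 < m -> g 0 m.-1) & (0 < m -> ~~ g N m.-1)].
Proof.
case/and3P=> w1; rewrite wordX => /andP[mN gm] w2; split=> //.
  by case: m w1 {gm w2} mN => [|[|m]] //; rewrite wordX => /andP[].
by case: m w2 {gm w1} mN => [|m] // w2 mN; rewrite wordY ?(ltnW mN) // in w2.
Qed.

Lemma sideB_facts (m : nat) : sideB m ->
  [/\ 0 < m <= N, g N m.-1, (m.+1 < N -> g N m.+1) & (m < N -> ~~ g 0 m.+1)].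
Proof.
case: m => [|m]; first by [].
case/andP=> mN /and3P[]; rewrite wordY // => w1 w3 w2; split=> // mN'.
  by rewrite wordY in w3.
by move: w2; rewrite wordX mN'.
Qed.

Lemma sideA0 : sideA 0.
Proof. by rewrite /sideA /windowA /= wordX gP ?andbT //; lia. Qed.

Lemma sideBN : sideB N.
Proof.
have gN : g N.-1 N by have := gP (i := N.-1); rewrite prednK; [apply; lia | lia].
have := wordY (j := N.-1); rewrite prednK; last lia.
move=> w1; rewrite /sideB /windowB leqnn w1 1?gC ?gN; last lia.
by rewrite /word ltnn (_ : N.+3 < N.+2 = false) //; lia.
Qed.

(** Rotations leave the initial segment 0, ..., c of the path alone, so only the part on [c..N] is
    recorded; [spans_le] prepends the rest. *)
Definition spans (c q : nat) : Prop :=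
  exists s, [/\ perm_eq (c :: s) (iota c (N.+1 - c)), path gA c s & last c s = q].

Lemma spans_bound (c q : nat) : spans c q -> c <= N.
Proof.
case=> s [ps _ _]; rewrite leqNgt; apply/negP=> cN.
by move: (perm_size ps); rewrite size_iota /=; lia.
Qed.

Lemma spans_pred (c q : nat) : spans c.+1 q -> spans c q.
Proof.
move=> sc; have cN := spans_bound sc; case: sc => s [ps gs ls].
exists (c.+1 :: s); split=> //=; last by rewrite gA_step.
by rewrite (_ : N.+1 - c = (N.+1 - c.+1).+1) 1?perm_cons //; lia.
Qed.

Lemma spans_le (c d q : nat) : spans c q -> d <= c -> spans d q.
Proof.
move=> sc; elim: c sc => [|c IH] sc; first by rewrite leqn0 => /eqP->.
rewrite leq_eqVlt => /predU1P[-> //|]; exact/IH/spans_pred.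
Qed.

(** A rotation: step from i to q and run the path on [i + 1..N] backwards. *)
Lemma spans_rotate (i q : nat) : spans i.+1 q -> gA i q -> spans i i.+1.
Proof.
move=> sc iq; have iN := spans_bound sc; case: sc => s [ps gs ls].
exists (rev (i.+1 :: s)); split; last exact: last_rev_cons.
  rewrite (_ : N.+1 - i = (N.+1 - i.+1).+1); last lia.
  by rewrite perm_cons perm_rev.
by apply: path_revl => //; [exact: gA_sym | rewrite ls].
Qed.

Lemma spans_end (q : nat) : spans 0 q -> ~~ g 0 q.
Proof.
case=> s [ps gs <-]; rewrite subn0 in ps; apply: noham => //.
exact: (sub_path sub_gA).
Qed.

(* A rotation at a would make a.-1 or a.+1 an end, and both are adjacent to 0. *)
Lemma spans_sideA (a q : nat) : spans 0 q -> ~~ sideA q -> sideA a -> ~~ g q a.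
Proof.
move=> sq qA aA; have [aN ga1 ga2 _] := sideA_facts aA.
have [->|a0] := posnP a; first by rewrite gC spans_end.
case: sq => s [ps gs ls]; apply/negP=> gqa; rewrite subn0 in ps.
have as_ : a \in s.
  have : a \in 0 :: s by rewrite (perm_mem ps) mem_iota; lia.
  by rewrite inE => /predU1P[a0'|//]; rewrite a0' in a0.
case/splitPr: as_ ps gs ls => s1 [|c s2] ps gs.
  by rewrite last_cat => /= aq; rewrite -aq aA in qA.
rewrite last_cat => /= ls.
move: gs; rewrite cat_path => /= /and4P[gs1 gla gac gs2].
have g0c : g 0 c.
  have c0 : c != 0.
    have := perm_uniq ps; rewrite iota_uniq /= mem_cat !inE => /andP[/norP[_]].
    by rewrite !negb_or => /and3P[_ c0 _] _; rewrite eq_sym.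
  have := gac; rewrite /gA aA => /andP[_ /orP[]] /eqP ca; last by rewrite ca.
  have ca' : c = a.-1 by clear -ca; lia.
  by rewrite ca' ga2 //; clear -ca c0; lia.
apply: (@no_ham (s1 ++ a :: rev (c :: s2))).
- apply: perm_trans ps; rewrite perm_cons perm_cat2l perm_cons perm_rev.
  exact: perm_refl.
- rewrite cat_path /= (sub_path sub_gA gs1) (sub_gA gla) /=.
  apply: path_revl => //; first exact: (sub_path sub_gA).
  by rewrite ls gC.
- by rewrite last_cat /= last_rev_cons.
Qed.

(* The two ways of linking N and b to the positions q.-1 and q by disjoint paths that
   together cover [b] and [q..N]. *)
Definition linked (b q : nat) : Prop :=
  exists p1 p2, [/\ perm_eq (N :: p1 ++ p2) (iota q (N.+1 - q)), path gA N p1, path gA b p2 &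
    (last N p1 = q /\ gA (last b p2) q.-1) \/ (gA (last N p1) q.-1 /\ last b p2 = q)].

(** The second alternative is a pair of paths not yet joined. The edges from N to b - 1 and b + 1
    can join it, but leaving it open lets [reachable_step] pass to smaller positions with the same
    b. *)
Definition reachable (q : nat) : Prop :=
  spans q.-1 q \/ exists b, [/\ sideB b, b < q.-1 & linked b q].

Lemma sideB_notA (b : nat) : sideB b -> ~~ sideA b.
Proof.
move=> bB; have [/andP[b0 _] gb _ _] := sideB_facts bB.
by apply/negP=> /sideA_facts[_ _ _ /(_ b0)]; rewrite gb.
Qed.

Lemma gA_N (j : nat) : 0 < j <= N -> g N j.-1 -> gA N j.-1.
Proof.
move=> jN gj; apply: gA_notA => //; first exact/sideB_notA/sideBN.
apply/negP=> /sideA_facts[_]; rewrite prednK; last lia.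
move=> g0j _ _; have := lab_disjoint (j := j.-1); rewrite prednK ?gj; last lia.
by move/(_ _ g0j); lia.
Qed.

Lemma gA_sideB_pred (b : nat) : sideB b -> gA N b.-1.
Proof. by case/sideB_facts=> bN gb _ _; apply: gA_N. Qed.

Lemma gA_sideB_succ (b : nat) : sideB b -> b.+1 < N -> gA N b.+1.
Proof.
move=> bB bN; have [b0 gb gb1 _] := sideB_facts bB.
apply: gA_notA; rewrite ?gb1 //; first exact/sideB_notA/sideBN.
apply/negP=> /sideA_facts[_ _ g0b _]; have {}g0b : g 0 b by apply: g0b; lia.
by have := lab_disjoint (j := b.-1); rewrite prednK ?gb ?g0b; [move/(_ _ isT); lia | lia].
Qed.

Lemma linked_spans (b q : nat) : sideB b -> b < q.-1 -> q <= N -> linked b q ->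
  spans b.-1 q.
Proof.
move=> bB bq qN [p1 [p2 [pp gp1 gp2 ends]]]; have [/andP[b0 _] _ _ _] := sideB_facts bB.
case: ends => [] [l1 l2].
  apply: (@spans_le b); last exact: leq_pred.
  (* The path b, [p2], then q - 1 down to b + 1, then N, [p1]; it uses the edge from b + 1 to N. *)
  exists (p2 ++ rev (iota b.+1 (q.-1 - b)) ++ N :: p1).
  have eq : iota b.+1 (q.-1 - b) = b.+1 :: iota b.+2 (q - b - 2).
    by rewrite (_ : q.-1 - b = (q - b - 2).+1) //; lia.
  split.
  - rewrite (@iota_split b (N.+1 - b) (q - b)) ?subnKC; try lia.
    rewrite (_ : N.+1 - b - (q - b) = N.+1 - q); last lia.
    rewrite (_ : q - b = (q.-1 - b).+1) /=; last lia.
    rewrite perm_cons; apply/permP=> P; move/permP: pp => /(_ P).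
    by rewrite !count_cat count_rev /= !count_cat; lia.
  - rewrite cat_path gp2 eq cat_path last_rev_cons /= gp1 andbT.
    rewrite path_revl ?last_iota //=; first 1 last.
    + exact: gA_sym.
    + by apply: path_iota => j Hj; apply: gA_step; lia.
    + by rewrite (_ : b.+1 + _ = q.-1) //; lia.
    by rewrite gA_sym gA_sideB_succ //; lia.
  - by rewrite !last_cat.
(* The path b - 1, N, [p1], then q - 1 down to b, then [p2]; it uses the edge from b - 1 to N. *)
exists (N :: p1 ++ rev (iota b (q - b)) ++ p2).
have eq : iota b (q - b) = b :: iota b.+1 (q.-1 - b).
  by rewrite (_ : q - b = (q.-1 - b).+1) //; lia.
split.
- rewrite (_ : N.+1 - b.-1 = (N.+1 - b).+1) /= 1?prednK //; last lia.
  rewrite perm_cons (@iota_split b (N.+1 - b) (q - b)) ?subnKC; try lia.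
  rewrite (_ : N.+1 - b - (q - b) = N.+1 - q); last lia.
  apply/permP=> P; move/permP: pp => /(_ P).
  by rewrite /= !count_cat count_rev /= ; lia.
- rewrite /= gA_sym gA_sideB_pred // cat_path gp1 eq cat_path last_rev_cons gp2 andbT.
  apply: path_revl; first exact: gA_sym.
    by apply: path_iota => j Hj; apply: gA_step; lia.
  by rewrite last_iota (_ : b + _ = q.-1) //; lia.
- by rewrite /= !last_cat eq last_rev_cons.
Qed.

Lemma reachable_spans (q : nat) : q <= N -> reachable q -> spans 0 q.
Proof.
move=> qN [sq|[b [bB bq lq]]]; first exact: (spans_le sq).
exact: (spans_le (linked_spans bB bq qN lq)).
Qed.

Lemma reachable_adjN (q : nat) : 0 < q <= N -> g N q.-1 -> reachable q.
Proof.
move=> qN gq; left.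
have eq : iota q (N.+1 - q) = q :: iota q.+1 (N - q).
  by rewrite (_ : N.+1 - q = (N - q).+1) //; lia.
exists (rev (iota q (N.+1 - q))); split.
- rewrite (_ : N.+1 - q.-1 = (N.+1 - q).+1) /= 1?prednK 1?perm_cons ?perm_rev //; lia.
- rewrite eq; apply: path_revl; first exact: gA_sym.
    by apply: path_iota => j Hj; apply: gA_step; lia.
  by rewrite last_iota gA_sym (_ : q + _ = N) ?gA_N //; lia.
- by rewrite eq last_rev_cons.
Qed.

Lemma reachable_sideB (b : nat) : sideB b -> reachable b.
Proof. by case/sideB_facts=> bN gb _ _; apply: reachable_adjN. Qed.

(** N runs down to i + 1, and the path from b is trivial. *)
Lemma reachable_below (b i : nat) : sideB b -> b < i < N -> gA b i -> reachable i.+1.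
Proof.
move=> bB bi gbi; right; exists b; split=> //=; first lia.
have eq : iota i.+1 (N - i) = rcons (iota i.+1 (N - i.+1)) N.
  rewrite (@iota_split i.+1 (N - i) (N - i.+1)); last lia.
  by rewrite (_ : i.+1 + _ = N) 1?(_ : N - i - _ = 1) ?cats1 //; lia.
have eq1 : iota i.+1 (N - i) = i.+1 :: iota i.+2 (N - i.+1).
  by rewrite (_ : N - i = (N - i.+1).+1) //; lia.
have lastN : last i.+1 (iota i.+2 (N - i.+1)) = N by rewrite last_iota; lia.
exists (rev (iota i.+1 (N - i.+1))), [::]; rewrite cats0 subSS -rev_rcons -eq.
have revE : rev (belast i.+1 (iota i.+2 (N - i.+1))) = rev (iota i.+1 (N - i.+1)).
  have := congr1 rev eq; rewrite eq1 lastI lastN !rev_rcons; by case.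
split=> //; first by rewrite perm_rev.
  rewrite -revE -{1}lastN rev_path.
  rewrite (eq_path (e' := gA)) => [|z w /=]; last exact: gA_sym.
  by apply: path_iota => j Hj; apply: gA_step; lia.
left; split=> //; have := last_rev_cons i.+1 N (iota i.+2 (N - i.+1)).
by rewrite -eq1 eq rev_rcons.
Qed.

(** A path on a tail is rotated at i, after joining the pair if b > i. If b < i, the path that ends
    next to q - 1 continues from q - 1 down to i + 1, and the other one ends at q, a neighbour of i:
    the two alternatives of [linked] swap. *)
Lemma reachable_step (i q : nat) : q <= N -> reachable q -> i.+1 < q -> g i q ->
  ~~ sideA i -> ~~ sideA q -> ~~ sideB i -> ~~ sideB i.+1 -> reachable i.+1.
Proof.
move=> qN rq iq giq iA qA iB iB1; have gAiq := gA_notA giq iA qA.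
have below c : i < c -> spans c q -> reachable i.+1.
  by move=> ic sc; left; apply: spans_rotate (spans_le sc ic) gAiq.
case: rq => [sq|[b [bB bq lq]]]; first by apply: below sq; lia.
have bi : b != i by apply: contraNneq iB => <-.
have bi1 : b != i.+1 by apply: contraNneq iB1 => <-.
have [/andP[b0 _] _ _ _] := sideB_facts bB.
have [ib|ib] := ltnP i b.
  by apply: below (linked_spans bB bq qN lq); lia.
right; exists b; split=> //=; first lia.
have eq : iota i.+1 (q.-1 - i) = i.+1 :: iota i.+2 (q - i - 2).
  by rewrite (_ : q.-1 - i = (q - i - 2).+1) //; lia.
have cnt P : count P (iota i.+1 (N.+1 - i.+1)) =
    count P (iota i.+1 (q.-1 - i)) + count P (iota q (N.+1 - q)).
  rewrite (@iota_split i.+1 (N.+1 - i.+1) (q.-1 - i)); last lia.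
  rewrite count_cat (_ : i.+1 + _ = q); last lia.
  by rewrite (_ : N.+1 - i.+1 - _ = N.+1 - q) //; lia.
have down z : gA z q.-1 -> path gA z (rev (iota i.+1 (q.-1 - i))).
  move=> zq; rewrite eq; apply: path_revl; first exact: gA_sym.
    by apply: path_iota => j Hj; apply: gA_step; lia.
  by rewrite last_iota (_ : i.+1 + _ = q.-1) //; lia.
case: lq => [p1 [p2 [pp gp1 gp2 [[l1 l2]|[l1 l2]]]]].
  exists p1, (p2 ++ rev (iota i.+1 (q.-1 - i))); split=> //.
  - apply/permP=> P; move/permP: pp => /(_ P).
    by rewrite cnt /= !count_cat count_rev; clear; lia.
  - by rewrite cat_path gp2 down.
  - by right; rewrite l1 gA_sym last_cat eq last_rev_cons.
exists (p1 ++ rev (iota i.+1 (q.-1 - i))), p2; split=> //.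
- apply/permP=> P; move/permP: pp => /(_ P).
  by rewrite cnt /= !count_cat count_rev; clear; lia.
- by rewrite cat_path gp1 down.
- by left; rewrite l2 gA_sym last_cat eq last_rev_cons.
Qed.

Lemma lab_trueP (j : nat) : lab j = Some true -> g 0 j.+1.
Proof. by rewrite /lab; case: (g 0 _) => //; case: (g N _). Qed.

Lemma lab_falseP (j : nat) : lab j = Some false -> ~~ g 0 j.+1 /\ g N j.
Proof. by rewrite /lab; case: (g 0 _) => //; case: (g N _). Qed.

Lemma lab_noneP (j : nat) : lab j = None -> ~~ g 0 j.+1 /\ ~~ g N j.
Proof. by rewrite /lab; case: (g 0 _) => //; case: (g N _). Qed.

Lemma sideAB_nonadj (a b : nat) : sideA a -> sideB b -> ~~ g b a.
Proof.
move=> aA bB; have [/andP[_ bN] _ _ _] := sideB_facts bB.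
by apply: spans_sideA aA => //; [exact/reachable_spans/reachable_sideB | exact: sideB_notA].
Qed.

Section Gap.

Variables (k r : nat).
Hypotheses (kr : 0 < k <= r) (rN : r < N).
Hypotheses (labk : lab k.-1 = Some false) (labr : lab r = Some true).
Hypothesis labkr : forall j, k <= j < r -> lab j = None.

(** The word Y O ... O X has no X before its last letter and no Y after its first; the third
    conjuncts of the windows settle the boundary cases. *)
Lemma gap_notAB (i : nat) : k <= i <= r ->
  [/\ ~~ sideA i, ~~ sideA i.+1, ~~ sideB i & ~~ sideB i.+1].
Proof.
move=> ki; have [g0k gNk] := lab_falseP labk; rewrite prednK in g0k; last lia.
have g0r := lab_trueP labr; have gNr := lab_disjoint rN g0r.
have Oj j : k <= j < r -> ~~ g 0 j.+1 /\ ~~ g N j by move=> Hj; apply/lab_noneP/labkr.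
have g0i : ~~ g 0 i.
  have [<-//|ki'] := eqVneq k i; have [|+ _] := Oj i.-1; first lia.
  by rewrite prednK //; lia.
have gNi : ~~ g N i.
  by have [->|ir] := eqVneq i r; [rewrite gNr | have [|] := Oj i; first lia].
split; apply/negP.
- move=> /sideA_facts[_ g0i1 gp gNp].
  have ir : i = r by apply/eqP/negPn/negP => ir; have [|/negP] := Oj i; first lia.
  have [ki'|ki'] := eqVneq k i; first by move: gNp; rewrite -ki' gNk; lia.
  have [ki2|ki2] := eqVneq k i.-1; first by move: gp; rewrite -ki2 (negbTE g0k); lia.
  have [|+ _] := Oj i.-2; first lia.
  by rewrite prednK ?gp //; lia.
- by move=> /sideA_facts[_ _ /= gp _]; move: gp; rewrite (negbTE g0i); lia.
- move=> /sideB_facts[_ gp gs g0i1].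
  have ir : i < r.
    rewrite ltn_neqAle; apply/andP; split; last lia.
    by apply: contraTneq g0r => <-; apply: g0i1; lia.
  have [ir1|ir1] := eqVneq i.+1 r; first by move: gs; rewrite ir1 gNr; lia.
  by have [|_ /negP] := Oj i.+1; [lia | apply; apply: gs; lia].
- by move=> /sideB_facts[_ /= gp _ _]; rewrite gp in gNi.
Qed.

(* Starting from u = k, move to the next position as long as the current one has a neighbour
   that makes the next one reachable; r.+1 is not reachable, being adjacent to 0. *)
Lemma gap_vertex : exists u, [/\ k <= u <= r, reachable u,
  forall b, sideB b -> b < u -> ~~ g u b &
  forall q, u.+1 < q <= N -> reachable q -> ~~ sideA q -> ~~ g u q].
Proof.
apply: NNPP => none.
suff reach d : k + d <= r.+1 -> reachable (k + d).
  have := reach (r.+1 - k); rewrite subnKC; last lia.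
  move=> /(_ (leqnn _)) /(reachable_spans rN) /spans_end.
  by rewrite lab_trueP.
elim: d => [_|d IH dr].
  by rewrite addn0; apply: reachable_adjN; [lia | have [] := lab_falseP labk].
rewrite addnS in dr *; have {}IH := IH (ltnW dr).
set i := k + d in dr IH *; have [|iA _ iB iB1] := @gap_notAB i; first lia.
apply: NNPP => nreach; apply: none; exists i; split=> //; first lia.
- move=> b bB bi; apply/negP=> gib; apply: nreach.
  apply: (reachable_below bB); first lia.
  by rewrite gA_sym gA_notA // sideB_notA.
- move=> q qN rq qA; apply/negP=> giq; apply: nreach.
  by apply: (reachable_step (q := q)); lia || assumption.
Qed.

End Gap.

Definition neither (m : nat) : bool := ~~ sideA m && ~~ sideB m.

Lemma prev_word (j : nat) : j <= N -> prev word j.+2 = prev lab j.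
Proof.
elim: j => [|j IH] // jN.
by rewrite -[LHS]/(odflt (prev word j.+2) (word j.+2)) IH ?(ltnW jN) // /word /= !ltnS jN.
Qed.

Lemma sum_word (F : nat -> nat) (G : nat -> nat) :
  F 0 = 0 -> F 1 = 0 -> F N.+2 = 0 -> F N.+3 = 0 -> (forall j, j < N -> F j.+2 = G j) ->
  \sum_(0 <= j < N.+4) F j = \sum_(0 <= j < N) G j.
Proof.
move=> F0 F1 F2 F3 FG; rewrite big_nat_recr // big_nat_recr //= F2 F3 !addn0.
rewrite big_nat_recl // big_nat_recl //= F0 F1 !add0n.
by apply: eq_big_nat => j /andP[_ /FG].
Qed.

Lemma sum_neither :
  \sum_(0 <= m < N.+1) neither m
  <= 2 * \sum_(0 <= j < N) (lab j == None) + 4 * \sum_(0 <= j < N) jump lab j + 1.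
Proof.
have wlab j : j < N -> word j.+2 = lab j by move=> jN; rewrite /word /= !ltnS jN.
have wN2 : word N.+2 = Some false by rewrite /word /= ltnn.
have wN3 : word N.+3 = Some false by rewrite /word /= ltnNge leqnSn.
have w2 : word 2 = Some true by apply/eqP; rewrite wordX // gP; lia.
(* The virtual letters at both ends contribute neither an O nor a jump. *)
have := @sum_windows_le word N.+1 erefl erefl w2.
rewrite (sum_word (G := fun j => lab j == None)) ?wN2 ?wN3 //; last by move=> j /wlab->.
rewrite (sum_word (G := fun j => jump lab j)) /jump ?wN2 ?wN3 //; last first.
  by move=> j jN; rewrite prev_word ?wlab // ltnW.
apply: leq_trans; rewrite leq_eqVlt; apply/orP; left; apply/eqP.
apply: eq_big_nat => m /andP[_ mN]; by rewrite /neither /sideB -ltnS mN.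
Qed.

Lemma jump_gap (r : nat) : r < N -> jump lab r ->
  exists k, [/\ 0 < k <= r, lab k.-1 = Some false & forall j, k <= j < r -> lab j = None].
Proof.
move=> _ /andP[_]; elim: r => [|r IH] //=.
case er: (lab r) => [[]|] //=.
  by move=> _; exists r.+1; split=> // [|j]; lia.
case/IH=> k [kr labk labkr]; exists k; split=> //; first lia.
move=> j Hj; have [->//|jr] := eqVneq j r.
by apply: labkr; lia.
Qed.

Hypothesis gI : irreflexive g.

Lemma gap_vertices : exists U : seq nat,
  [/\ uniq U, size U = \sum_(0 <= j < N) jump lab j, {in U, forall u, u <= N /\ neither u},
    {in U & , forall u v, ~~ g u v} & {in U, forall u m, m <= N -> g u m -> neither m}].
Proof.
pose P (r : 'I_N) (u : nat) := jump lab r -> exists k, [/\ 0 < k <= r, lab k.-1 = Some false,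
  forall j, k <= j < r -> lab j = None & [/\ k <= u <= r, reachable u,
  forall b, sideB b -> b < u -> ~~ g u b &
  forall q, u.+1 < q <= N -> reachable q -> ~~ sideA q -> ~~ g u q]].
have [|u uP] := @fin_all_exists _ _ P.
  move=> r; case jr: (jump lab r); last by exists 0; rewrite /P jr.
  have [k [kr labk labkr]] := jump_gap (ltn_ord r) jr.
  have labr : lab r = Some true by case/andP: jr => /eqP.
  have [u uP] := gap_vertex kr (ltn_ord r) labk labr labkr.
  by exists u => _; exists k.
(* [gap_vertex] says nothing about the pair u, u + 1, so gap vertices must be at distance at least
   2. The X at r1 lies before the Y at k2 - 1, whence u r1 <= r1 < k2 - 1 < u r2. *)
have apart (r1 r2 : 'I_N) : jump lab r1 -> jump lab r2 -> r1 < r2 -> (u r1).+1 < u r2.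
  move=> j1 j2 r12; have [k1 [_ _ _ [kr1 _ _ _]]] := uP r1 j1.
  have [k2 [kr2 labk2 labkr2 [ku2 _ _ _]]] := uP r2 j2.
  have lab1 : lab r1 = Some true by case/andP: j1 => /eqP.
  have : ~~ (k2 <= r1) by apply/negP=> kr; have := labkr2 r1; rewrite lab1 kr r12 => /(_ isT).
  have : k2.-1 != r1 by apply/eqP=> kr; rewrite kr lab1 in labk2.
  by lia.
have uAB (r : 'I_N) : jump lab r ->
    [/\ u r <= N, ~~ sideA (u r), ~~ sideB (u r) & ~~ sideB (u r).+1].
  move=> jr; have [k [kr labk labkr [ku _ _ _]]] := uP r jr.
  have labr : lab r = Some true by case/andP: jr => /eqP.
  have rN := ltn_ord r.
  have [//|? _ ? ?] := gap_notAB kr rN labk labr labkr (i := u r).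
  by split=> //; lia.
have rE r1 r2 : r1 != r2 :> 'I_N -> r1 < r2 \/ r2 < r1.
  by move=> /eqP r12; apply/orP; rewrite -neq_ltn; apply: contra_not_neq r12 => /val_inj.
exists (map u [seq r : 'I_N <- enum 'I_N | jump lab r]); split.
- rewrite map_inj_in_uniq; first exact/filter_uniq/enum_uniq.
  move=> r1 r2; rewrite !mem_filter => /andP[j1 _] /andP[j2 _] e.
  apply/eqP/negPn/negP=> /rE[/(apart _ _ j1 j2)|/(apart _ _ j2 j1)]; rewrite e; lia.
- rewrite size_map size_filter -sum1_count big_mkcond /= big_enum /= big_mkord.
  by apply: eq_bigr => r _; case: (jump _ _).
- move=> _ /mapP[r /[!mem_filter] /andP[jr _] ->].
  by have [? ? ? _] := uAB r jr; split=> //; apply/andP.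
- move=> _ _ /mapP[r1 /[!mem_filter] /andP[j1 _] ->] /mapP[r2 /[!mem_filter] /andP[j2 _] ->].
  have sep (s1 s2 : 'I_N) : jump lab s1 -> jump lab s2 -> s1 < s2 -> ~~ g (u s1) (u s2).
    move=> js1 js2 s12; have [_ [_ _ _ [_ _ _ far]]] := uP s1 js1.
    have [_ [_ _ _ [_ reach _ _]]] := uP s2 js2.
    have [? ? _ _] := uAB s2 js2; apply: far => //.
    by rewrite apart.
  have [->|/rE[r12|r12]] := eqVneq r1 r2; [by rewrite gI|exact: sep|by rewrite gC; apply: sep].
- move=> _ /mapP[r /[!mem_filter] /andP[jr _] ->] m mN gum.
  have [uN uA uB uB1] := uAB r jr; have [k [_ _ _ [_ reach near far]]] := uP r jr.
  rewrite /neither; apply/andP; split; apply/negP=> mS.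
    by have := spans_sideA (reachable_spans uN reach) uA mS; rewrite gum.
  have [mu|um] := ltnP m (u r); first by have := near _ mS mu; rewrite gum.
  have mu1 : m != (u r).+1 by apply: contraNneq uB1 => <-.
  have mu0 : m != u r by apply: contraNneq uB => <-.
  have := far m; rewrite gum; move/(_ _ _ _)/negP; apply; rewrite ?sideB_notA //; first lia.
  exact: reachable_sideB.
Qed.

End HamiltonPath.

(** * The closure lemma *)

(* Toughness tested on any colouring that is constant on the components of G - S. *)
Definition tough_colouring (T : finType) (e : rel T) (t : nat) : Prop :=
  forall (S : {set T}) (h : T -> T),
    (forall x y, x \notin S -> y \notin S -> e x y -> h x = h y) ->
    2 <= #|h @: ~: S| -> t * #|h @: ~: S| <= #|S|.

(** Every colour is taken at the root of some component. *)
Lemma colours_ncomp (T : finType) (e : rel T) (S : {set T}) (h : T -> T) :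
  symmetric e -> (forall x y, x \notin S -> y \notin S -> e x y -> h x = h y) ->
  #|h @: ~: S| <= ncomp_del e S.
Proof.
move=> eC hS; set d := del_rel e S.
have dC : connect_sym d.
  by apply: sym_connect_sym => x y; rewrite /d /del_rel /= eC andbCA.
have dh x y : connect d x y -> x \notin S -> y \notin S /\ h x = h y.
  case/connectP=> p; elim: p x => [|z p IH] x /=; first by move=> _ ->.
  by case/andP=> /and3P[xS zS xz] /IH{}IH /IH/(_ zS)[yS <-] _; split=> //; apply: hS.
apply: leq_trans (leq_imset_card h _); apply/subset_leq_card/subsetP=> _ /imsetP[x xS ->].
rewrite inE in xS; have [rS hr] := dh _ _ (connect_root d x) xS.
by apply/imsetP; exists (fingraph.root d x) => //; rewrite !inE (roots_root dC) rS.
Qed.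

Lemma tough_colouringP (T : finType) (e : rel T) (t : nat) :
  symmetric e -> tough e t%:R -> tough_colouring e t.
Proof.
move=> eC; rewrite /tough /toughness => te S h hS h2.
have hc := colours_ncomp eC hS; have c2 := leq_trans h2 hc.
move: te; case: ifP => [/forallP ce|_].
  have [_ [_ [/imsetP[x xS ->] /imsetP[y yS ->]]]] := card_gt1P h2.
  rewrite !inE in xS yS; move=> hxy; case/negP: (hxy); apply/eqP/hS => //.
  by apply: (implyP (forallP (ce x) y)); apply: contraNneq hxy => ->.
move=> te; have := le_trans te (bigmin_le_cond _ _ c2).
rewrite lee_fin ler_pdivlMr ?ltr0n; last exact: leq_trans c2.
rewrite -natrM ler_nat; apply: leq_trans.
by rewrite leq_mul2l hc orbT.
Qed.

Section Positions.

Variables (T : finType) (e : rel T) (x0 : T) (p : seq T) (N : nat).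
Hypotheses (pU : uniq p) (pN : size p = N.+1) (pT : #|T| = N.+1).

Local Notation v := (nth x0 p).

Lemma perm_positions : perm_eq p (enum T).
Proof.
apply: uniq_perm => //; first exact: enum_uniq.
have sub : {subset p <= enum T} by move=> z _; rewrite mem_enum.
have sz : size (enum T) <= size p by rewrite -cardE pT pN.
by have [_ pE] := uniq_min_size pU sub sz; apply: pE.
Qed.

Lemma card_positions (P : pred T) : #|[set z | P z]| = \sum_(0 <= j < N.+1) P (v j).
Proof.
rewrite -sum1_card (eq_bigl P) => [|z]; last by rewrite inE.
rewrite big_mkcond -big_enum /= -(perm_big _ perm_positions) (big_nth x0) pN.
by apply: eq_bigr => j _; case: (P _).
Qed.

Lemma ham_positions (s : seq nat) : 3 <= #|T| -> perm_eq (0 :: s) (iota 0 N.+1) ->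
  path (relpre v e) 0 s -> symmetric e -> e (v 0) (v (last 0 s)) -> hamiltonian e.
Proof.
move=> T3 ps es eC elast.
have pv : perm_eq (map v (0 :: s)) p.
  by rewrite -[in X in perm_eq _ X](mkseq_nth x0 p) pN; apply: perm_map.
exists (map v (0 :: s)); split.
- by rewrite (perm_size pv) pN -pT.
- rewrite /ucycle (perm_uniq pv) pU andbT /= rcons_path path_map es /=.
  by rewrite last_map eC.
- by move=> z; rewrite (perm_mem pv) (perm_mem perm_positions) mem_enum.
Qed.

End Positions.

Lemma sum_mem (U : seq nat) (n : nat) : uniq U -> {in U, forall u, u < n} ->
  \sum_(0 <= m < n) (m \in U) = size U.
Proof.
move=> Uu Un; rewrite -(@perm_size _ [seq m <- iota 0 n | m \in U]).
  rewrite size_filter -sum1_count [RHS]big_mkcond /index_iota subn0.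
  by apply: eq_bigr => m _; case: ifP.
apply: uniq_perm => //; first exact/filter_uniq/iota_uniq.
by move=> m; rewrite mem_filter mem_iota andb_idr // => /Un.
Qed.

Lemma closure_lemma (T : finType) (e : rel T) (t : nat) (x0 : T) (p : seq T) :
  3 <= t -> simple_graph e -> 3 <= #|T| -> tough_colouring e t ->
  uniq p -> size p = #|T| -> sorted e p ->
  #|T| <= degree e (head x0 p) + degree e (last x0 p) + t -> hamiltonian e.
Proof.
move=> t3 [eC eI] T3 et pU pT ep dxy; apply: NNPP => nham.
set N := #|T|.-1; have TN : #|T| = N.+1 by rewrite /N prednK //; lia.
have pN : size p = N.+1 by rewrite pT.
set v := nth x0 p; pose g (i j : nat) := e (v i) (v j).
have v0 : head x0 p = v 0 by rewrite /v nth0.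
have vN : last x0 p = v N by rewrite /v -nth_last pN.
have gC : symmetric g by move=> i j; rewrite /g /= eC.
have gI : irreflexive g by move=> i; rewrite /g /= eI.
have gP i : i < N -> g i i.+1.
  by move=> iN; apply/sortedP; rewrite // pN ltnS.
have N2 : 2 <= N by rewrite -ltnS -TN.
have noham s : perm_eq (0 :: s) (iota 0 N.+1) -> path g 0 s -> ~~ g 0 (last 0 s).
  by move=> ps gs; apply/negP=> gl; apply/nham/(ham_positions pU pN TN T3 ps gs eC).
have [U [Uu Us Un UU UAB]] := gap_vertices gC gP N2 noham gI.
have sumn := sum_neither gP N2.
set gaps := \sum_(0 <= j < N) jump _ _ in Us sumn.
(* Each of the N path edges has exactly one label; X counts the neighbours of x and Y those of y. *)
have labs : \sum_(0 <= j < N) (lab N g j == None) + degree e (v 0) + degree e (v N) = N.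
  rewrite /degree !(card_positions x0 pU pN TN) big_nat_recl //= eI add0n.
  rewrite big_nat_recr //= eI addn0 -!big_split /= -[RHS]subn0 -[RHS]muln1 -sum_nat_const_nat.
  apply: eq_big_nat => j /andP[_ jN]; rewrite /lab.
  have := lab_disjoint gC gP N2 noham jN; rewrite /g /=.
  by case: (e (v 0) _) => [->|_] //; case: (e (v N) _).
have pos j : j <= N -> index (v j) p = j by move=> jN; rewrite index_uniq // pN ltnS.
have vpos z : v (index z p) = z.
  by rewrite /v nth_index // (perm_mem (perm_positions pU pN TN)) mem_enum.
have posN z : index z p <= N.
  by rewrite -ltnS -pN index_mem (perm_mem (perm_positions pU pN TN)) mem_enum.
(* S is everything outside A, B and the gap vertices. A and B get one colour each, every gap vertex
   its own. *)
pose S := [set z | neither N g (index z p) && (index z p \notin U)].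
pose h z := if index z p \in U then z else if sideA N g (index z p) then v 0 else v N.
have cS : #|S| + size U = \sum_(0 <= m < N.+1) neither N g m.
  rewrite (card_positions x0 pU pN TN) -(sum_mem Uu (n := N.+1)); last by move=> u /Un[].
  rewrite -big_split /=; apply: eq_big_nat => m /andP[_ mN]; rewrite pos //.
  by case mU: (m \in U); [have [_ ->] := Un _ mU | rewrite andbT addn0].
have memS z : (z \notin S) = ~~ neither N g (index z p) || (index z p \in U).
  by rewrite inE negb_and negbK.
have nn m : ~~ neither N g m = sideA N g m || sideB N g m.
  by rewrite /neither; case: (sideA _ _ _); case: (sideB _ _ _).
have hS z z' : z \notin S -> z' \notin S -> e z z' -> h z = h z'.
  rewrite !memS => zS zS' ezz.
  have gzz : g (index z p) (index z' p) by rewrite /g /= !vpos.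
  have zU : index z p \notin U.
    apply/negP=> zU; have nz' := UAB _ zU _ (posN z') gzz.
    by move: zS'; rewrite nz' /= => zU'; have := UU _ _ zU zU'; rewrite gzz.
  have zU' : index z' p \notin U.
    rewrite gC in gzz; apply/negP=> zU'; have nz := UAB _ zU' _ (posN z) gzz.
    by move: zS; rewrite nz /= (negbTE zU).
  move: zS zS'; rewrite /h (negbTE zU) (negbTE zU') !orbF !nn.
  case: ifP => zA; case: ifP => zA' //= zB zB'.
    by have := sideAB_nonadj gC gP N2 noham zA zB'; rewrite gC gzz.
  by have := sideAB_nonadj gC gP N2 noham zA' zB; rewrite gzz.
have h2 : 2 + size U <= #|h @: ~: S|.
  pose c := 0 :: N :: U.
  have A0 : sideA N g 0 by apply: sideA0.
  have BN : sideB N g N by apply: sideBN.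
  have NA : ~~ sideA N g N by apply: sideB_notA BN.
  have U0 : 0 \notin U by apply/negP=> /Un[_]; rewrite /neither A0.
  have UN : N \notin U by apply/negP=> /Un[_]; rewrite /neither BN andbF.
  have cu : uniq c by rewrite /= inE (negbTE U0) UN Uu !andbT; lia.
  have cN j : j \in c -> j <= N by rewrite !inE => /or3P[/eqP->|/eqP->|/Un[]].
  have -> : 2 + size U = #|[set z in map v c]|.
    rewrite cardsE; have/card_uniqP -> : uniq (map v c); last by rewrite size_map.
    by rewrite map_inj_in_uniq // => i j /cN/pos {2}<- /cN/pos {2}<- ->.
  apply/subset_leq_card/subsetP=> z; rewrite inE => /mapP[j jc ->].
  have jN := cN _ jc; apply/imsetP; exists (v j).
    move: jc; rewrite in_setC memS nn !inE pos // => /or3P[/eqP->|/eqP->|->].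
    - by rewrite A0.
    - by rewrite BN orbT.
    - by rewrite orbT.
  move: jc; rewrite /h pos // !inE => /or3P[/eqP->|/eqP->|->] //.
    by rewrite (negbTE U0) A0.
  by rewrite (negbTE UN) (negbTE NA).
have := et S h hS (leq_trans (leq_addr _ _) h2).
rewrite v0 vN in dxy; rewrite TN in dxy.
have : t * (2 + size U) <= t * #|h @: ~: S| by rewrite leq_mul2l h2 orbT.
have : 3 * size U <= t * size U by rewrite leq_mul2r t3 orbT.
by move: cS sumn labs dxy; rewrite -Us; lia.
Qed.

(** * Degrees *)

Definition add_edge (T : finType) (e : rel T) (x y : T) : rel T :=
  [rel u w | [|| e u w, (u == x) && (w == y) | (u == y) && (w == x)]].

Lemma complete_hamiltonian (T : finType) (e : rel T) :
  3 <= #|T| -> (forall x y, x != y -> e x y) -> hamiltonian e.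
Proof.
move=> T3 eT; exists (enum T); split; [by rewrite -cardE | | by move=> x; rewrite mem_enum].
rewrite /ucycle enum_uniq andbT; have := enum_uniq T; rewrite cardE in T3.
case: (enum T) T3 => [|x s] // s3 xs; rewrite /cycle rcons_path.
apply/andP; split.
  rewrite uniq_pairwise in xs; have /= := pairwise_sorted xs.
  by apply: sub_path => a b /eT.
case/lastP: s s3 xs => [|s z] // _; rewrite last_rcons /= mem_rcons inE negb_or eq_sym.
by case/andP=> /andP[/eT].
Qed.

(** The cycle must use the new edge. Read from x, that edge comes last and is dropped, or it comes
    first and the rest is read backwards. *)
Lemma ham_path_of_add_edge (T : finType) (e : rel T) (x y : T) :
  symmetric e -> x != y -> hamiltonian (add_edge e x y) -> ~ hamiltonian e ->
  exists p, [/\ uniq p, size p = #|T|, sorted e p, head x p = x & last x p = y].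
Proof.
move=> eC xy [c [c3 /andP[cc cu] call]] nham.
case: (rot_to (call x)) => i s cs.
have su : uniq (x :: s) by rewrite -cs rot_uniq.
have sc : cycle (add_edge e x y) (x :: s) by rewrite -cs rot_cycle.
have sall z : z \in x :: s by rewrite -cs mem_rot.
have s3 : 3 <= size (x :: s) by rewrite -cs size_rot.
have sT : size (x :: s) = #|T|.
  by rewrite -(card_uniqP su); apply: eq_card => z; rewrite sall.
case: s {cs} su sc sall s3 sT => [|z s] // su sc sall s3 sT.
have zx : z != x by move: su; rewrite /= inE eq_sym; case/andP=> /norP[].
have xs : x \notin s by move: su; rewrite /= inE; case/andP=> /norP[].
move: sc; rewrite /= rcons_path => /and3P[xz zs sx].
have pzs : path e z s.
  have allx : all (predC1 x) (z :: s).
    by rewrite /= zx; apply/allP=> a /= aS; apply: contraNneq xs => <-.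
  apply: sub_in_path allx zs => a b /=.
  by rewrite !inE => /negbTE ax /negbTE bx; rewrite /add_edge /= ax bx andbF !orbF.
have lx : last z s != x.
  by apply: contraNneq xs => lx; have := mem_last z s; rewrite lx inE eq_sym (negbTE zx).
move: xz; rewrite /add_edge /= eqxx (negbTE xy) orbF => /orP[xz|/eqP zy].
  move: sx; rewrite /add_edge /= (negbTE lx) eqxx andbT /= => /orP[sx|/eqP ly].
    case: nham; exists [:: x, z & s]; split=> //.
    by rewrite /ucycle su andbT /= rcons_path xz pzs.
  by exists [:: x, z & s]; split=> //=; rewrite xz.
(* A cycle of length at least 3 does not return to x from y as well. *)
have ly : last z s != y.
  move: su s3; rewrite /= -zy; case/lastP: (s) => [|s' w] // /and3P[_ + _] _.
  by rewrite last_rcons mem_rcons inE eq_sym; case/norP.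
exists (x :: rev (z :: s)); split=> //=.
- by rewrite rev_uniq mem_rev.
- by rewrite size_rev.
- apply: path_revl => //; move: sx.
  by rewrite /add_edge /= (negbTE lx) (negbTE ly) !orbF eC.
- by rewrite last_rev_cons.
Qed.

Definition deg_le (T : finType) (e : rel T) (s : nat) : nat := #|[set z | degree e z <= s]|.

(* d_j <= j and d_(n-j+t) < n-j, in terms of the counting function of the degree sequence. *)
Definition defective (T : finType) (e : rel T) (t j : nat) : bool :=
  (j <= deg_le e j) && (#|T| - j + t <= deg_le e (#|T| - j - 1)).

(** A form of the degree condition that survives adding edges. *)
Definition one_defect (T : finType) (e : rel T) (t : nat) : Prop :=
  forall i j, 1 <= i -> i < j -> j <= (#|T| - 1) %/ 2 ->
    defective e t i -> defective e t j -> False.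

Section MaximalNonhamiltonian.

Variables (T : finType) (e : rel T) (t : nat).
Hypotheses (t3 : 3 <= t) (eG : simple_graph e) (T3 : 3 <= #|T|).
Hypothesis et : tough_colouring e t.
Hypothesis defect : one_defect e t.
Hypothesis nham : ~ hamiltonian e.
Hypothesis emax : forall x y, x != y -> ~~ e x y -> hamiltonian (add_edge e x y).

Local Notation n := #|T|.
Local Notation d := (degree e).
Local Notation F := (deg_le e).
Local Notation m := ((#|T| - 1) %/ 2).

Let eC : symmetric e := proj1 eG.
Let eI : irreflexive e := proj2 eG.

(** By maximality, nonadjacent x and y are the ends of a Hamiltonian path, to which [closure_lemma]
    applies. *)
Lemma adj_of_degree (x y : T) : x != y -> n <= d x + d y + t -> e x y.
Proof.
move=> xy dxy; apply/negPn/negP=> nxy; apply: nham.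
have [p [pu pT ep px py]] := ham_path_of_add_edge eC xy (emax xy nxy) nham.
by apply: (closure_lemma (x0 := x) t3 eG T3 et pu pT ep); rewrite px py.
Qed.

Lemma deg_le_compl (s : nat) : F s + #|[set z | s < d z]| = n.
Proof.
rewrite /deg_le -(cardsC [set z | d z <= s]); congr (_ + _).
by apply: eq_card => z; rewrite !inE ltnNge.
Qed.

Lemma deg_le_mono (s s' : nat) : s <= s' -> F s <= F s'.
Proof.
by move=> ss; apply/subset_leq_card/subsetP=> z; rewrite !inE => /leq_trans; apply.
Qed.

Lemma card_adj (v : T) (H : {set T}) :
  v \notin H -> (forall w, w \in H -> w != v -> e v w) -> #|H| <= d v.
Proof.
move=> vH Hv; apply/subset_leq_card/subsetP=> w wH; rewrite inE Hv //.
by apply: contraNneq vH => <-.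
Qed.

Lemma degree_ge (w : T) (s : nat) :
  (forall z, z != w -> ~~ e w z -> d z <= s) -> n <= d w + 1 + F s.
Proof.
move=> Hw; rewrite -addnA -cardsT /degree /deg_le -(cards1 w).
apply: leq_trans (leq_trans (leq_card_setU _ _) (leq_add (leqnn _) (leq_card_setU _ _))).
apply/subset_leq_card/subsetP=> z _; rewrite !inE.
have [->|zw] := eqVneq z w; first by rewrite orbT.
by case ewz: (e w z) => //=; apply: Hw; rewrite ?ewz.
Qed.

(** All vertices of degree at least n - d(v) - t are adjacent to v. This gives the second half of a
    defect at d(v) + t. *)
Lemma few_high (v : T) : 2 * d v + t < n -> n - d v <= F (n - d v - t - 1).
Proof.
move=> dv; have := deg_le_compl (n - d v - t - 1).
have : #|[set z | n - d v - t - 1 < d z]| <= d v; last by lia.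
apply: card_adj => [|w]; first by rewrite inE; lia.
by rewrite inE => dw wv; apply: adj_of_degree; [rewrite eq_sym | lia].
Qed.

(** A vertex w of H misses only vertices of degree at most d(v), fewer than d(v) + t of them; its
    degree is then large enough to force w ~ v. *)
Lemma card_dominating (v : T) (H : {set T}) : F (d v) < d v + t ->
  (forall w, w \in H -> d v < d w) ->
  (forall w z, w \in H -> d v < d z -> z != w -> e w z) -> #|H| <= d v.
Proof.
move=> Fv Hd Hadj; apply: card_adj => [|w wH wv].
  by apply/negP=> /Hd; rewrite ltnn.
apply: adj_of_degree; first by rewrite eq_sym.
suff : n <= d w + 1 + F (d v) by lia.
apply: degree_ge => z zw; apply: contraR; rewrite -ltnNge => dz.
exact: Hadj.
Qed.

(** Every vertex of degree d(v) turns out to have neighbourhood U. If smaller degrees occur, U is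
    too large for [card_dominating]; otherwise removing U isolates too many vertices. *)
Lemma least_defect_absurd (v : T) : d v + t <= m -> d v + t <= F (d v) ->
  (forall j, 1 <= j -> j < d v + t -> ~~ defective e t j) -> False.
Proof.
move=> vm Fv ndef; pose U := [set z | n - d v - t <= d z].
have v2 : 2 * d v + t < n by lia.
have Uadj v' w : d v' = d v -> w \in U -> w != v' -> e v' w.
  by rewrite inE => dv' dw wv; apply: adj_of_degree; [rewrite eq_sym | lia].
have Udeg w : w \in U -> d v < d w by rewrite inE; lia.
(* There is no defect at d(v) + t - 1, although its first half holds; so the second half fails. *)
have Ule : d v <= #|U|.
  have := ndef (d v + t - 1); rewrite /defective negb_and -!ltnNge.
  have := deg_le_mono (s := d v) (s' := d v + t - 1).
  have := deg_le_compl (n - (d v + t - 1) - 1).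
  have : #|[set z | n - (d v + t - 1) - 1 < d z]| <= #|U|.
    by apply/subset_leq_card/subsetP=> z; rewrite !inE; lia.
  by lia.
have UE v' : d v' = d v -> [set z | e v' z] = U.
  move=> dv'; apply/esym/eqP; rewrite eqEcard -/(degree e v') dv' Ule andbT.
  apply/subsetP=> w wU; rewrite inE; apply: Uadj => //.
  by apply: contraTneq wU => ->; apply/negP=> /Udeg; rewrite dv' ltnn.
(* For the largest degree below d(v), every vertex of greater degree has degree at least d(v) and is
   adjacent to U. *)
have [/existsP[z0 z0v]|] := boolP [exists z, d z < d v].
  case: (@arg_maxnP T z0 (fun z => d z < d v) d z0v) => v' v'v vmax.
  have : #|U| <= d v'; last by lia.
  apply: card_dominating.
  - have := ndef (d v' + t); rewrite /defective negb_and -!ltnNge.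
    have := @few_high v'; have := deg_le_mono (s := d v') (s' := d v' + t).
    rewrite (_ : n - (d v' + t) + t = n - d v') 1?(_ : n - (d v' + t) = n - d v' - t); lia.
  - by move=> w /Udeg; lia.
  - move=> w z wU dz zw; apply: adj_of_degree; first by rewrite eq_sym.
    have : d v <= d z by rewrite leqNgt; apply/negP=> /vmax; lia.
    by move: wU; rewrite inE; lia.
rewrite negb_exists => /forallP vmin.
pose W := [set z | d z <= d v].
have WU z z' : z \in W -> z' \notin U -> e z z' = false.
  rewrite inE => zv z'U; have dz : d z = d v.
    by apply/eqP; rewrite eqn_leq zv leqNgt vmin.
  by have := UE _ dz; move/setP/(_ z'); rewrite inE (negbTE z'U).
pose h z := if z \in W then z else v.
have WU0 z : z \in W -> z \notin U.
  by rewrite inE => zW; apply/negP=> /Udeg; lia.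
have WF : #|W| <= #|h @: ~: U|.
  apply/subset_leq_card/subsetP=> z zW; apply/imsetP; exists z.
    by rewrite inE WU0.
  by rewrite /h zW.
have hU x y : x \notin U -> y \notin U -> e x y -> h x = h y.
  move=> xU yU exy; rewrite /h; case: ifP => xW.
    by rewrite WU in exy.
  by case: ifP => yW //; rewrite eC WU in exy.
have WFv : #|W| = F (d v) by [].
have := et hU; have : #|U| <= d v.
  by apply: card_adj => [|w wU wv]; [apply/negP=> /Udeg; rewrite ltnn | apply: Uadj].
have : t * (d v + t) <= t * #|h @: ~: U| by rewrite leq_mul2l; lia.
by nia.
Qed.

(** A violation makes d(v) + t a defect, and then no smaller index is one. *)
Lemma deg_le_bound (v : T) : d v + t <= m -> F (d v) < d v + t.
Proof.
move=> vm; rewrite ltnNge; apply/negP=> Fv; apply: (least_defect_absurd vm Fv) => j j1 jv.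
apply/negP=> dj; apply: (defect j1 jv vm dj); rewrite /defective.
have := deg_le_mono (s := d v) (s' := d v + t); have := @few_high v.
by rewrite (_ : n - (d v + t) + t = n - d v) 1?(_ : n - (d v + t) = n - d v - t); lia.
Qed.

Lemma nonadjacent_pair : exists x y, x != y /\ ~~ e x y.
Proof.
apply: NNPP => none; apply: nham; apply: complete_hamiltonian => // x y xy.
by apply/negPn/negP=> nxy; apply: none; exists x, y.
Qed.

(** The neighbourhood of v separates v from any vertex w not adjacent to it. *)
Lemma min_degree (v : T) : d v + 1 < n -> 2 * t <= d v.
Proof.
move=> dv; have [w wv ew] : exists2 w, w != v & ~~ e v w.
  apply: NNPP => none.
  suff : n <= d v + 1 + 0 by lia.
  rewrite -addnA addn0 -cardsT -(cards1 v) /degree.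
  apply: leq_trans (leq_card_setU _ _); apply/subset_leq_card/subsetP=> z _.
  rewrite !inE orbC; have [//|zv] := eqVneq z v.
  by apply/negPn/negP=> nz; apply: none; exists z.
pose h z := if z == v then v else w.
have h2 : 2 <= #|h @: ~: [set z | e v z]|.
  apply/card_gt1P; exists v, w; split; last by rewrite eq_sym.
    by apply/imsetP; exists v; rewrite ?inE ?eI // /h eqxx.
  by apply/imsetP; exists w; rewrite ?inE // /h (negbTE wv).
apply: leq_trans (et _ h2); first by rewrite mulnC leq_mul2l h2 orbT.
move=> x y; rewrite !inE /h => nx ny exy.
have [xv|_] := eqVneq x v; have [yv|_] := eqVneq y v => //.
  by rewrite xv (negbTE ny) in exy.
by rewrite yv eC (negbTE nx) in exy.
Qed.

(** The vertices of degree above d(v) form a clique H. If H had more than n - d(v) - t members, each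
    would be adjacent to v, so |H| <= d(v), a contradiction. *)
Lemma many_low (v : T) : 2 * d v + t < n -> (forall z, d v < d z -> n <= 2 * d z + t) ->
  d v + t <= F (d v).
Proof.
move=> dv vmax; rewrite leqNgt; apply/negP=> Fv.
have cF := deg_le_compl (d v); set H := [set z | d v < d z] in cF.
suff : #|H| <= d v by lia.
apply: card_adj => [|w]; first by rewrite inE ltnn.
rewrite inE => dw wv; apply: adj_of_degree; first by rewrite eq_sym.
have : #|H :\ w| <= d w.
  apply: card_adj => [|z]; first by rewrite !inE eqxx.
  rewrite !inE => /andP[zw dz] _; apply: adj_of_degree; first by rewrite eq_sym.
  by have := vmax _ dz; have := vmax _ dw; lia.
by have := cardsD1 w H; rewrite inE dw; lia.
Qed.

(** Otherwise m - 1 and m are both defects. *)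
Lemma many_high (v : T) : 2 * d v + t < n -> m < d v + t -> d v + t <= F (d v) ->
  m - t <= #|[set z | n - m <= d z]|.
Proof.
move=> dv vm Fv; rewrite leqNgt; apply/negP=> Hm.
have dt := @min_degree v; have Fm := deg_le_mono (s := d v) (s' := m).
have Fm1 := deg_le_mono (s := d v) (s' := m - 1).
apply: (defect (i := m - 1) (j := m)); rewrite /defective; try lia.
  have := deg_le_compl (n - (m - 1) - 1).
  have : #|[set z | n - (m - 1) - 1 < d z]| <= #|[set z | n - m <= d z]|.
    by apply/subset_leq_card/subsetP=> z; rewrite !inE; lia.
  by lia.
have := deg_le_compl (n - m - 1).
have : #|[set z | n - m - 1 < d z]| <= #|[set z | n - m <= d z]|.
  by apply/subset_leq_card/subsetP=> z; rewrite !inE; lia.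
by lia.
Qed.

(* In a Hamiltonian path between two nonadjacent vertices, the first vertex and the
   successors of the vertices of H are independent. *)
Lemma universal_bound (H : {set T}) : 0 < #|H| ->
  (forall w z, w \in H -> z != w -> e w z) -> t.+1 * #|H|.+1 <= n.
Proof.
move=> H0 Huniv; have [x [y [xy nxy]]] := nonadjacent_pair.
have [p [pu pT ep px py]] := ham_path_of_add_edge eC xy (emax xy nxy) nham.
pose N := n.-1; have TN : n = N.+1 by rewrite /N prednK //; lia.
have pN : size p = N.+1 by rewrite pT.
pose v j := nth x p j; pose g (i j : nat) := e (v i) (v j).
have v0 : v 0 = x by rewrite /v nth0.
have vN : v N = y by rewrite -py /v -nth_last pN.
have gC : symmetric g by move=> i j; rewrite /g eC.
have gP i : i < N -> g i i.+1 by move=> iN; apply/sortedP; rewrite // pN ltnS.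
have N2 : 2 <= N by rewrite -ltnS -TN.
have noham s : perm_eq (0 :: s) (iota 0 N.+1) -> path g 0 s -> ~~ g 0 (last 0 s).
  by move=> ps gs; apply/negP=> gl; apply/nham/(ham_positions pu pN TN T3 ps gs eC).
have xH : x \notin H.
  by apply/negP=> xH; have := Huniv x y xH; rewrite eq_sym xy (negbTE nxy) => /(_ isT).
have yH : y \notin H.
  by apply/negP=> yH; have := Huniv y x yH; rewrite xy eC (negbTE nxy) => /(_ isT).
have vpos z : v (index z p) = z.
  by rewrite /v nth_index // (perm_mem (perm_positions pu pN TN)) mem_enum.
have pos j : j <= N -> index (v j) p = j by move=> jN; rewrite index_uniq // pN ltnS.
have posN z : index z p <= N.
  by rewrite -ltnS -pN index_mem (perm_mem (perm_positions pu pN TN)) mem_enum.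
have posH z : z \in H -> index z p < N.
  move=> zH; rewrite ltn_neqAle posN andbT.
  by apply: contraNneq yH => zN; rewrite -vN -zN vpos.
have univ k j : v k \in H -> k <= N -> j <= N -> j != k -> g k j.
  move=> kH kN jN jk; apply: Huniv => //.
  by apply: contraNneq jk => vjk; rewrite -(pos j) // vjk pos.
have Hpos k : v k \in H -> k <= N -> 0 < k < N.
  move=> kH kN; rewrite -[in k < N](pos k) // posH // andbT lt0n.
  by apply: contraNneq xH => k0; rewrite -v0 -k0.
have succ_x k : v k \in H -> k <= N -> ~~ g 0 k.+1.
  move=> kH kN; have /andP[k0 kN1] := Hpos k kH kN.
  apply/negP=> g0k; have := lab_disjoint gC gP N2 noham kN1 g0k.
  by rewrite gC univ //; lia.
have succ_succ k l : v k \in H -> v l \in H -> k < l -> l <= N -> ~~ g k.+1 l.+1.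
  move=> kH lH kl lN; have /andP[l0 lN1] := Hpos l lH lN.
  have k0 := Hpos k kH (leq_trans (ltnW kl) lN).
  by apply: (crossing_free gC gP N2 noham); rewrite ?kl ?lN1 // univ //; lia.
pose succ z := v (index z p).+1.
pose I := x |: succ @: H.
have xI : x \notin succ @: H.
  apply/imsetP=> -[z zH] xz; have := posH z zH => zN.
  by have := pos 0 (leq0n _); rewrite v0 xz pos.
have cI : #|I| = #|H|.+1.
  rewrite cardsU1 xI card_in_imset // => z w zH wH zw.
  have := pos _ (posH z zH); rewrite -/(succ z) zw pos ?posH // => -[zw'].
  by rewrite -(vpos z) -zw' vpos.
have indI a b : a \in I -> b \in I -> ~~ e a b.
  have Hv z : z \in H -> v (index z p) \in H by rewrite vpos.
  rewrite !in_setU1 => /predU1P[->|/imsetP[z zH ->]] /predU1P[->|/imsetP[w wH ->]].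
  - by rewrite eI.
  - by rewrite -v0; apply: (succ_x _ (Hv w wH)).
  - by rewrite eC -v0; apply: (succ_x _ (Hv z zH)).
  - have [zw|wz|zw] := ltngtP (index z p) (index w p); last by rewrite /succ zw eI.
      by apply: (succ_succ _ _ (Hv z zH) (Hv w wH)).
    by rewrite eC; apply: (succ_succ _ _ (Hv w wH) (Hv z zH)).
(* Removing the complement of I leaves |I| isolated vertices. *)
have := @et (~: I) id; rewrite setCK imset_id cI.
have -> : #|~: I| = n - #|H|.+1 by rewrite -cI cardsCs setCK.
have In : #|I| <= n by apply: max_card.
move=> H1; have : t * #|H|.+1 <= n - #|H|.+1.
  apply: H1 => // a b; rewrite !inE !negbK => aI bI eab.
  by have := indI a b; rewrite !in_setU1 aI bI eab => /(_ isT isT).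
by rewrite mulSn; rewrite cI in In; lia.
Qed.

Lemma maximal_nonhamiltonian_absurd : False.
Proof.
have [x [y [xy nxy]]] := nonadjacent_pair.
have [v0 dv0] : exists v, 2 * d v + t < n.
  have : d x + d y + t < n.
    by rewrite ltnNge; apply: contra nxy; apply: adj_of_degree.
  by move=> dxy; have [yx|yx] := leqP (d x) (d y); [exists x | exists y]; lia.
case: (@arg_maxnP T v0 (fun z => 2 * d z + t < n) d dv0) => v dv vmax.
have low : d v + t <= F (d v).
  apply: many_low => // z vz; rewrite leqNgt; apply/negP=> /vmax; lia.
have vm : m < d v + t by rewrite ltnNge; apply/negP=> /deg_le_bound; lia.
have := many_high dv vm low; set H := [set z | n - m <= d z] => high.
have dt := @min_degree v.
(* Otherwise take w of largest degree below m - t: H dominates all vertices of greater degree, so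
   |H| <= d(w) < m - t. *)
have all_high z : m - t <= d z.
  rewrite leqNgt; apply/negP=> dz.
  case: (@arg_maxnP T z (fun z => d z < m - t) d dz) => w dw wmax.
  have : #|H| <= d w; last by lia.
  apply: card_dominating.
  - by apply: deg_le_bound; lia.
  - by move=> u; rewrite inE; lia.
  - move=> u z' uH dz' zu; apply: adj_of_degree; first by rewrite eq_sym.
    have : m - t <= d z' by rewrite leqNgt; apply/negP=> /wmax; lia.
    by move: uH; rewrite inE; lia.
have := @universal_bound H; have -> : 0 < #|H| by lia.
move=> /(_ isT) bound; have : t.+1 * #|H|.+1 <= n.
  apply: bound => u z uH zu; apply: adj_of_degree; first by rewrite eq_sym.
  by move: uH (all_high z); rewrite inE; lia.
have : t.+1 * (m - t).+1 <= t.+1 * #|H|.+1 by rewrite leq_mul2l; lia.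
(* As v is not universal, d(v) >= 2 t and n > 5 t, contrary to (t + 1) (m - t + 1) <= n <= 2 m +
   2. *)
by nia.
Qed.

End MaximalNonhamiltonian.

(** * Reduction to the edge-maximal case, and the degree sequence *)

Lemma add_edge_simple (T : finType) (e : rel T) (x y : T) :
  simple_graph e -> x != y -> simple_graph (add_edge e x y).
Proof.
move=> [eC eI] xy; split=> [a b|a]; rewrite /add_edge /=.
  by rewrite eC [(a == x) && _]andbC [(a == y) && _]andbC [_ || _ && (a == x)]orbC.
rewrite eI /=; apply/negP=> /orP[] /andP[/eqP-> ab]; first by rewrite ab in xy.
by rewrite eq_sym ab in xy.
Qed.

Lemma deg_le_add_edge (T : finType) (e : rel T) (x y : T) (s : nat) :
  deg_le (add_edge e x y) s <= deg_le e s.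
Proof.
apply/subset_leq_card/subsetP=> z; rewrite !inE; apply: leq_trans.
by apply/subset_leq_card/subsetP=> w; rewrite !inE /add_edge /= => ->.
Qed.

(** Induction on the number of nonadjacent pairs. Colourings for the larger graph are colourings for
    [e], and its defects are defects of [e]. *)
Lemma tough_one_defect_hamiltonian (T : finType) (e : rel T) (t : nat) :
  3 <= t -> simple_graph e -> 3 <= #|T| -> tough_colouring e t -> one_defect e t ->
  hamiltonian e.
Proof.
move=> t3 eG T3; have [k ek] := ubnP #|[set xy | ~~ e xy.1 xy.2]|.
elim: k e eG ek => // k IH e eG ek et defect; apply: NNPP => nham.
apply: (maximal_nonhamiltonian_absurd t3 eG T3 et defect nham) => x y xy nxy.
apply: IH; first exact: add_edge_simple.
- rewrite ltnS in ek; apply: leq_trans ek; apply/proper_card/properP; split.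
    by apply/subsetP=> -[a b]; rewrite !inE /= negb_or => /andP[].
  by exists (x, y); rewrite !inE /add_edge /= ?nxy ?eqxx ?orbT.
- by move=> S h hS; apply: et => a b aS bS eab; apply: hS; rewrite // /add_edge /= eab.
- move=> i j i1 ij jm di dj; have mono l : defective (add_edge e x y) t l -> defective e t l.
    case/andP=> l1 l2.
    by rewrite /defective !(leq_trans _ (deg_le_add_edge e x y _)).
  exact: (defect i j i1 ij jm (mono _ di) (mono _ dj)).
Qed.

Lemma deg_seq_le (T : finType) (e : rel T) (i s : nat) :
  0 < i -> i <= deg_le e s -> deg_seq e i <= s.
Proof.
move=> i0 iF; rewrite /deg_seq -leEnat; apply: nth_count_le.
  by have := sort_sorted leq_total [seq degree e x | x <- enum T].
suff -> : count (fun y => (y <= s)%O) (sort leq [seq degree e x | x <- enum T]) = deg_le e s.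
  by rewrite prednK.
rewrite (permP (permEl (perm_sort _ _))) count_map /deg_le cardE enumT /enum_mem size_filter.
by apply: eq_count => z; rewrite !inE leEnat.
Qed.

Theorem theorem4 (t : nat) (T : finType) (e : rel T) (n : nat) :
  4 <= t ->
  simple_graph e ->
  #|T| = n ->
  3 <= n ->
  tough e (t%:R)%R ->
  (forall i : nat, 1 <= i <= (n - 1) %/ 2 ->
     deg_seq e i <= i -> deg_seq e (n - i + t) < n - i ->
     forall j : nat, i + 1 <= j <= (n - 1) %/ 2 ->
       n <= deg_seq e j + deg_seq e (n - j + t)) ->
  hamiltonian e.
Proof.
move=> t4 eG Tn n3 te dcond; have [eC _] := eG.
apply: (@tough_one_defect_hamiltonian _ _ t) => //; rewrite ?Tn //; first exact: ltnW.
  exact: tough_colouringP.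
move=> i j i1 ij jm /andP[di1 di2] /andP[dj1 dj2]; rewrite Tn in jm di2 dj2.
have low l : 1 <= l -> l <= deg_le e l -> deg_seq e l <= l by apply: deg_seq_le.
have high l : n - l + t <= deg_le e (n - l - 1) -> deg_seq e (n - l + t) <= n - l - 1.
  by apply: deg_seq_le; rewrite addn_gt0 (leq_trans _ t4) ?orbT.
have ir : 1 <= i <= (n - 1) %/ 2 by lia.
have jr : i + 1 <= j <= (n - 1) %/ 2 by lia.
(* A defect at j gives d_j + d_(n-j+t) <= j + (n - j - 1) < n. *)
have := dcond i ir (low i i1 di1); have := high i di2; have := high j dj2.
have := low j (ltn_trans i1 ij) dj1.
move=> hj hj2 hi2 /(_ _ j jr); lia.
Qed.
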